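(* Let $A,B\in\mathbb{C}^{n\times n}$. Consider the following conditions: (i) the matrix pencil $A+\lambda B$ is singular; (ii) $(0,0)\in W(A,B)$; (iii) $W(A+\lambda B)=\mathbb{C}$. Then (i) implies (ii), and (ii) implies (iii).
   Context: A matrix pencil is $P(\lambda)=A+\lambda B$ with $A,B\in\mathbb{C}^{n\times n}$. Its spectrum is $\sigma(P(\lambda))=\{\lambda_0\in\mathbb{C}: P(\lambda_0)\text{ is not invertible}\}$, and the pencil is called singular if $\sigma(P(\lambda))=\mathbb{C}$. The numerical range of the pencil is $W(P(\lambda))=\{\lambda_0\in\mathbb{C}: x^*P(\lambda_0)x=0\text{ for some nonzero }x\in\mathbb{C}^n\}$. The joint numerical range of $A,B$ is $W(A,B)=\{(x^*Ax,x^*Bx): x\in\mathbb{C}^n,\ x^*x=1\}$. *)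

(* Defs.v *)
From HB Require Import structures.
From mathcomp Require Import all_boot all_order all_algebra.
From mathcomp Require Import complex.
From mathcomp Require Import boolp classical_sets reals.

Set Implicit Arguments.
Unset Strict Implicit.
Unset Printing Implicit Defensive.

Import Order.TTheory GRing.Theory Num.Theory.
Local Open Scope classical_set_scope.
Local Open Scope ring_scope.
Local Open Scope sesquilinear_scope.

Definition pencil (C : numClosedFieldType) (n : nat) (A B : 'M[C]_n) (l : C)
    : 'M[C]_n :=
  A + l *: B.

Definition spectrum (C : numClosedFieldType) (n : nat) (P : C -> 'M[C]_n)
    : set C :=
  [set l | P l \notin unitmx].

Definition singular_pencil (C : numClosedFieldType) (n : nat)
    (P : C -> 'M[C]_n) : Prop :=
  spectrum P = setT.

(* The scalar x^* M x, read off as the entry of a 1 x 1 matrix; [^t*] is the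
   conjugate transpose. *)
Definition quadform (C : numClosedFieldType) (n : nat) (M : 'M[C]_n)
    (x : 'cV[C]_n) : C :=
  (x ^t* *m M *m x) 0 0.

Definition numerical_range (C : numClosedFieldType) (n : nat)
    (P : C -> 'M[C]_n) : set C :=
  [set l | exists2 x : 'cV[C]_n, x != 0 & quadform (P l) x = 0].

Definition joint_numerical_range (C : numClosedFieldType) (n : nat)
    (A B : 'M[C]_n) : set (C * C) :=
  [set (quadform A x, quadform B x) |
     x in [set x : 'cV[C]_n | (x ^t* *m x) 0 0 = 1]].

(* Main.v *)
(** If [A + lambda B] is singular then, its determinant being the zero
    polynomial, it kills a nonzero polynomial vector [sum_i lambda^i x_i].
    Comparing coefficients, [A x_0 = 0] and [A x_(i+1) = - B x_i], so the span
    [V] of the [x_i] satisfies [B V <= A V], while the nonzero [x_i] of least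
    index lies in the kernel of [A], so [dim (A V) < dim V].  Hence some nonzero
    [x] in [V] is orthogonal to [A V], which contains both [A x] and [B x]. *)

Require Import Defs.
From mathcomp Require Import all_boot all_order all_algebra.
From mathcomp Require Import complex.
From mathcomp Require Import boolp classical_sets reals.
Import Order.TTheory GRing.Theory Num.Theory.
Local Open Scope classical_set_scope.
Local Open Scope ring_scope.
Local Open Scope complex_scope.

Lemma poly_eq0_horner (F : numDomainType) (p : {poly F}) :
  (forall a, p.[a] = 0) -> p = 0.
Proof.
(* In characteristic zero these [size p] numerals are distinct roots, one more than the degree of a
   nonzero [p] allows. *)
move=> p0; pose s := [seq k%:R : F | k <- iota 0 (size p)].
apply: (@roots_geq_poly_eq0 _ _ s); last by rewrite size_map size_iota.
  by apply/allP => a _; apply/rootP.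
by rewrite map_inj_uniq ?iota_uniq // => i j /eqP; rewrite eqr_nat => /eqP.
Qed.

Lemma det_pencil_poly_eq0 (F : numFieldType) (n : nat) (M N : 'M[F]_n) :
  (forall l, \det (M + l *: N) = 0) ->
  \det (map_mx polyC M + 'X *: map_mx polyC N) = 0.
Proof.
move=> det0; apply: poly_eq0_horner => l; rewrite -(det0 l).
rewrite -/(horner_eval l _) -det_map_mx; congr (\det _).
by apply/matrixP => i j; rewrite !mxE /= /horner_eval !hornerE.
Qed.

Lemma map_coefp_mulC (F : comNzRingType) (m n : nat) (v : 'rV[{poly F}]_m)
    (M : 'M[F]_(m, n)) (i : nat) :
  map_mx (coefp i) (v *m map_mx polyC M) = map_mx (coefp i) v *m M.
Proof.
apply/rowP => j; rewrite !mxE /= coef_sum.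
by apply: eq_bigr => k _; rewrite !mxE /= coefMC.
Qed.

(** The space [V] is the row space of [X], whose rows are the coefficient vectors of [v]; vectors
    act from the left, so kernels are left kernels. *)
Lemma pencil_rank_drop (F : fieldType) (n : nat) (M N : 'M[F]_n)
    (v : 'rV[{poly F}]_n) :
  v != 0 -> v *m (map_mx polyC M + 'X *: map_mx polyC N) = 0 ->
  exists k (X : 'M[F]_(k, n)),
    (X *m N <= X *m M)%MS /\ (\rank (X *m M) < \rank X)%N.
Proof.
move=> v0; rewrite mulmxDr -scalemxAr => vP0.
pose x i := map_mx (coefp i) v.
have xM0 : x 0%N *m M = 0.
  have /(congr1 (map_mx (coefp 0))) := vP0.
  rewrite -map_coefp_mulC => /rowP e; apply/rowP => j.
  by have := e j; rewrite !mxE /= coefD coefXM addr0 coef0.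
have xMS i : x i.+1 *m M = - (x i *m N).
  have /(congr1 (map_mx (coefp i.+1))) := vP0.
  rewrite -!map_coefp_mulC => /rowP e; apply/rowP => j.
  have := e j; rewrite !mxE /= coefD coefXM /= coef0.
  by move/eqP; rewrite addr_eq0 => /eqP.
(* All coefficients from index [k] on vanish, so [k] rows suffice; in particular [x k = 0] closes
   the chain after the last row. *)
pose k := \max_j size (v ord0 j).
have xk i : (k <= i)%N -> x i = 0.
  move=> ki; apply/rowP => j; rewrite !mxE /= nth_default //.
  by apply: leq_trans ki; exact: (leq_bigmax (F := fun j => size (v ord0 j))).
have exx : exists i, x i != 0.
  have /rV0Pn [j vj0] := v0; exists (size (v ord0 j)).-1.
  apply/rV0Pn; exists j; rewrite mxE /=.
  by have := vj0; rewrite -lead_coef_eq0 lead_coefE.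
have [m xm0 min_m] := ex_minnP exx.
have xmM0 : x m *m M = 0.
  (* For a positive index, the preceding coefficient vanishes by minimality, and [xMS] concludes. *)
  case: m xm0 min_m => // m _ min_m; rewrite xMS.
  have [->|/min_m] := eqVneq (x m) 0; first by rewrite mul0mx oppr0.
  by rewrite ltnn.
pose X := \matrix_(i < k) x i.
have xX i : (x i <= X)%MS.
  case: (ltnP i k) => [ik|/xk ->]; last exact: sub0mx.
  by rewrite -[x i](rowK (fun i : 'I_k => x i) (Ordinal ik)) row_sub.
exists k, X; split.
  apply/row_subP => i; rewrite row_mul rowK.
  by rewrite -[x i *m N]opprK -xMS -mulNmx submxMr // -scaleN1r scalemx_sub.
(* By rank-nullity the drop is the dimension of [X :&: kermx M], which contains the nonzero
   [x m]. *)
rewrite -(mxrank_mul_ker X M) -[ltnLHS]addn0 ltn_add2l lt0n mxrank_eq0.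
apply: contraNneq xm0 => XM0; rewrite -submx0 -XM0 sub_capmx xX.
exact/sub_kermxP.
Qed.

(** The map [y |-> y *m G], with [G] the adjoint of [Y], has rank at most [\rank Y], so it cannot be
    injective on the row space of [X]. *)
Lemma orthogonal_in_rank_drop (C : numClosedFieldType) (k n : nat)
    (X Y : 'M[C]_(k, n)) :
  (\rank Y < \rank X)%N ->
  exists y : 'rV[C]_n,
    [/\ y != 0, (y <= X)%MS & Y *m map_mx Num.conj y^T = 0].
Proof.
move=> rYX; pose G := map_mx Num.conj Y^T; pose K := (X :&: kermx G)%MS.
have K0 : K != 0.
  rewrite -mxrank_eq0 -lt0n -(ltn_add2l (\rank (X *m G))) mxrank_mul_ker addn0.
  by apply: leq_ltn_trans (mxrankM_maxr _ _) _; rewrite mxrank_map mxrank_tr.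
have := nz_row_sub K; rewrite sub_capmx => /andP[yX /sub_kermxP yG].
exists (nz_row K); split; rewrite ?nz_row_eq0 //.
have := congr1 (fun Z => map_mx Num.conj Z^T) yG.
by rewrite trmx_mul map_mxM /G trmxCK trmx0 map_mx0.
Qed.

(** A scalar is its own transpose; putting [y] on the left lets row-space inclusions apply. *)
Lemma quadform_trC (C : numClosedFieldType) (n : nat) (M : 'M[C]_n)
    (y : 'rV[C]_n) :
  quadform M y^T = (y *m M^T *m map_mx Num.conj y^T) 0 0.
Proof.
have -> : y *m M^T *m map_mx Num.conj y^T = (map_mx Num.conj y *m M *m y^T)^T.
  by rewrite !trmx_mul trmxK map_trmx mulmxA.
by rewrite [RHS]mxE /quadform trmxK.
Qed.

Lemma quadformZ (C : numClosedFieldType) (n : nat) (M : 'M[C]_n) (c : C)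
    (x : 'cV[C]_n) :
  quadform M (c *: x) = c^* * c * quadform M x.
Proof.
rewrite /quadform -scalemxAr [(c *: x)^T]linearZ /= map_mxZ.
by rewrite -!scalemxAl !mxE mulrCA mulrA.
Qed.

Lemma quadform_pencil (C : numClosedFieldType) (n : nat) (A B : 'M[C]_n) (l : C)
    (x : 'cV[C]_n) :
  quadform (pencil A B l) x = quadform A x + l * quadform B x.
Proof.
rewrite /quadform /pencil mulmxDr mulmxDl -scalemxAr -scalemxAl.
by rewrite [LHS]mxE [X in _ + X]mxE.
Qed.

Lemma normalize_quadform0 (C : numClosedFieldType) (n : nat) (A B : 'M[C]_n)
    (x : 'cV[C]_n) :
  x != 0 -> quadform A x = 0 -> quadform B x = 0 ->
  (0, 0) \in joint_numerical_range A B.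
Proof.
move=> x0 Ax0 Bx0; pose c := (sqrtC (quadform 1%:M x))^-1.
have x_gt0 : 0 < quadform 1%:M x.
  rewrite -[x]trmxK quadform_trC trmx1 mulmx1 -dotmxE dotmx_is_dotmx //.
  by apply: contraNneq x0 => xT0; rewrite -[x]trmxK xT0 trmx0.
have c_ge0 : 0 <= c by rewrite invr_ge0 sqrtC_ge0 ltW.
rewrite inE; exists (c *: x); last by rewrite !quadformZ Ax0 Bx0 !mulr0.
rewrite /= -[X in X *m (c *: x)]mulmx1 -/(quadform 1%:M (c *: x)) quadformZ.
rewrite (conj_Creal (ger0_real c_ge0)) -expr2 exprVn sqrtCK.
by rewrite mulVf // gt_eqF.
Qed.

Theorem theorem3p1 (R : realType) (n : nat) (A B : 'M[R[i]]_n) :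
  (singular_pencil (pencil A B) -> (0, 0) \in joint_numerical_range A B) /\
  ((0, 0) \in joint_numerical_range A B ->
     numerical_range (pencil A B) = setT).
Proof.
split=> [sing | ].
  (* Transposing turns the column kernels of the pencil into the row kernels supplied by [det0P]. *)
  have det0 l : \det (A^T + l *: B^T) = 0.
    have : spectrum (pencil A B) l by rewrite sing.
    rewrite /spectrum /= unitmxE unitfE negbK => /eqP.
    by rewrite -det_tr linearD linearZ.
  have /eqP/det0P[v v0 vP0] := det_pencil_poly_eq0 _ _ _ _ det0.
  have [k [X [XBA rX]]] := pencil_rank_drop _ _ _ _ _ v0 vP0.
  have [y [y0 yX Yy0]] := orthogonal_in_rank_drop _ _ _ _ _ rX.
  (* Used for [M = A] trivially and for [M = B] through [XBA]: then [y *m M^T] lies in the row space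
     of [X *m A^T], which is orthogonal to [y]. *)
  have qf0 M : (X *m M^T <= X *m A^T)%MS -> quadform M y^T = 0.
    move=> XMA; rewrite quadform_trC.
    have /submxP[D ->] := submx_trans (submxMr M^T yX) XMA.
    by rewrite -mulmxA Yy0 mulmx0 mxE.
  apply: (normalize_quadform0 _ _ _ _ y^T); [|exact: qf0 ..].
  by apply: contraNneq y0 => yT0; rewrite -[y]trmxK yT0 trmx0.
rewrite inE => -[x /= x1 [Ax0 Bx0]]; apply/seteqP; split=> // l _.
(* One vector serves every [l]; it is nonzero because its norm is 1. *)
exists x.
  by apply: contra_eq_neq x1 => ->; rewrite mulmx0 mxE eq_sym oner_neq0.
by rewrite quadform_pencil Ax0 Bx0 mulr0 addr0.
Qed.
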